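(* Let $A$ be an $\mathrm{SU}(3)$-invariant connection in temporal gauge on the $\mathrm{SO}(3)$-bundle $E_0\to X^*$, where $X^*=T^*\mathbb{CP}^2\setminus\mathbb{CP}^2$ carries the Calabi hyperkähler structure, so that $$A=(p_0\kappa+p_1\nu_1+p_2\nu_2)\otimes T_1+(q_0\kappa+q_1\nu_1+q_2\nu_2)\otimes T_2+(s_0\kappa+s_1\nu_1+s_2\nu_2)\otimes T_3$$ for some functions $p_j,q_j,s_j:(1,\infty)\to\mathbb{R}$ of $r$, $j=0,1,2$. Then: (a) $A$ is an $I$-$\mathrm{SU}(4)$-instanton if and only if $$p_0(r)=\frac{C_1}{r^2(1-r^4)},\quad q_0(r)=\frac{C_2}{r^2(1-r^4)},\quad s_0(r)=\frac{C_3}{r^2(1-r^4)}$$ and $p_1=p_2=q_1=q_2=s_1=s_2=0$, for some constants $C_1,C_2,C_3\in\mathbb{R}$. (b) $A$ is a $J$-$\mathrm{SU}(4)$-instanton if and only if $$p_2(r)=\frac{C_1}{(r^4-1)^{3/2}},\quad q_2(r)=\frac{C_2}{(r^4-1)^{3/2}},\quad s_2(r)=\frac{C_3}{(r^4-1)^{3/2}}$$ and $p_0=p_1=q_0=q_1=s_0=s_1=0$, for some constants $C_1,C_2,C_3\in\mathbb{R}$. (c) $A$ is a $K$-$\mathrm{SU}(4)$-instanton if and only if $$p_1(r)=\frac{C_1}{(r^4-1)^{3/2}},\quad q_1(r)=\frac{C_2}{(r^4-1)^{3/2}},\quad s_1(r)=\frac{C_3}{(r^4-1)^{3/2}}$$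 and $p_0=p_2=q_0=q_2=s_0=s_2=0$, for some constants $C_1,C_2,C_3\in\mathbb{R}$.
   Context: **Calabi structure.** $\mathrm{SU}(3)$ acts on $X=T^*\mathbb{CP}^2$ in the standard way; $X^*$ is the complement of the zero section. Let $K_0=\{\mathrm{diag}(e^{i\theta},e^{i\theta},e^{-2i\theta})\}\cong\mathrm{U}(1)$ and $N_{1,1}=\mathrm{SU}(3)/K_0$. Write the left-invariant Maurer–Cartan form of $\mathrm{SU}(3)$ as $$\eta=\begin{bmatrix} i(\zeta+\kappa)&\nu&\sigma\\-\overline\nu&i(\zeta-\kappa)&\mu\\-\overline\sigma&-\overline\mu&-2i\zeta\end{bmatrix},\quad \nu=\nu_1+i\nu_2,\ \sigma=\sigma_1+i\sigma_2,\ \mu=\mu_1+i\mu_2,$$ which defines real left-invariant $1$-forms $\zeta,\kappa,\nu_j,\sigma_j,\mu_j$. There is an $\mathrm{SU}(3)$-equivariant diffeomorphism $X^*\cong(1,\infty)\times N_{1,1}$, with coordinate $r\in(1,\infty)$; forms on $X^*$ are identified with their pullbacks to $(1,\infty)\times\mathrm{SU}(3)$. Put $a=\sqrt{(r^2-1)/2}$, $b=\sqrt{(r^2+1)/2}$, $c=r$, $f=\frac1r\sqrt{r^4-1}$, $dt=\sqrt{r^4/(r^4-1)}\,dr$, and $e^0=dt$, $e^1=a\sigma_1$, $e^2=a\sigma_2$, $e^3=b\mu_1$, $e^4=b\mu_2$, $e^5=c\nu_1$, $e^6=c\nu_2$, $e^7=f\kappa$. The Calabi metric is $g=\sum_{j=0}^7(e^j)^2$,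 with orientation $e^{0}\wedge e^1\wedge\cdots\wedge e^7$ and Kähler forms ($e^{ij}=e^i\wedge e^j$) $$\omega_I=-e^{07}+e^{56}+e^{12}-e^{34},\quad \omega_J=-e^{06}-e^{57}-e^{23}+e^{14},\quad \omega_K=e^{05}-e^{67}+e^{24}+e^{13}.$$ A connection $A$ with curvature $F_A$ is an $L$-$\mathrm{SU}(4)$-instanton ($L\in\{I,J,K\}$), also called primitive Hermitian Yang-Mills with respect to $L$, if $\ast F_A=-\frac12\omega_L^2\wedge F_A$. **Bundle and connections.** $E_0=X^*\times\mathrm{SO}(3)=(1,\infty)\times N_{1,1}\times\mathrm{SO}(3)$ is the trivial principal $\mathrm{SO}(3)$-bundle with $\mathrm{SU}(3)$ acting on $X^*$ only. The basis of $\mathfrak{so}(3)$ is $$T_1=\begin{bmatrix}0&0&0\\0&0&-1\\0&1&0\end{bmatrix},\ T_2=\begin{bmatrix}0&0&1\\0&0&0\\-1&0&0\end{bmatrix},\ T_3=\begin{bmatrix}0&-1&0\\1&0&0\\0&0&0\end{bmatrix}.$$ A connection on $E_0$ is in temporal gauge if its connection form has no $dr$ component; it is identified with its $\mathfrak{so}(3)$-valued connection $1$-form on $X^*$ pulled back to $(1,\infty)\times\mathrm{SU}(3)$. $\mathrm{SU}(3)$-invariant connections in temporal gauge are exactly those of the form displayed in the claim. *)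

(* Defs.v *)
From HB Require Import structures.
From mathcomp Require Import all_boot all_order all_algebra.
From mathcomp Require Import complex.
From mathcomp Require Import all_classical all_reals all_analysis.

Set Implicit Arguments.
Unset Strict Implicit.
Unset Printing Implicit Defensive.

Import Order.TTheory GRing.Theory Num.Theory.
Import numFieldNormedType.Exports.

Local Open Scope ring_scope.

(* Exterior algebra on generators th^0, ..., th^{n-1}: [u A] is the
   coefficient of th^A = th^{a_1} /\ ... /\ th^{a_k}, A = {a_1 < ... < a_k}. *)
Definition ext (K : comNzRingType) (n : nat) := {ffun {set 'I_n} -> K^o}.

Section Exterior.
Variables (K : comNzRingType) (n : nat).
Implicit Types (u v : ext K n) (A B : {set 'I_n}) (i : 'I_n).

(* th^A /\ th^B = shuffle_sign A B th^{A u B} when A and B are disjoint. *)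
Definition shuffle_sign A B : K :=
  (-1) ^+ (\sum_(i in A) #|[set j in B | (j < i)%N]|).

Definition monomial A : ext K n := [ffun B : {set 'I_n} => (B == A)%:R].

Definition wedge u v : ext K n :=
  [ffun A : {set 'I_n} => \sum_(B : {set 'I_n} | B \subset A)
               shuffle_sign B (A :\: B) * u B * v (A :\: B)].

(* Interior product with the i-th vector of the dual frame. *)
Definition contract i u : ext K n :=
  [ffun A : {set 'I_n} => if i \in A then 0 else shuffle_sign [set i] A * u (i |: A)].

End Exterior.

Definition mxwedge (K : comNzRingType) (n m : nat) (M N : 'M[ext K n]_m) :
    'M[ext K n]_m :=
  \matrix_(i, j) \sum_k wedge (M i k) (N k j).

Definition mx3 (V : nmodType) (rows : seq (seq V)) : 'M[V]_3 :=
  \matrix_(i, j) (nth [::] rows i)`_j.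

(* An SU(3)-invariant form on (1,oo) x SU(3) has coefficients depending on r
   only in the left-invariant coframe
     dr, sigma_1, sigma_2, mu_1, mu_2, nu_1, nu_2, kappa, zeta
   (indices 0, ..., 8 in this order), so it is a function R -> ext R 9, of
   which only the values at r > 1 matter.  Forms pulled back from X^* have no
   zeta component. *)

Notation coframe K k := (monomial K [set @Ordinal 9 k isT]).

Section MaurerCartan.
Variable R : realType.
Local Notation C := R[i].

Definition conj_form (u : ext C 9) : ext C 9 := [ffun A : {set 'I_9} => (u A)^*%C].
Definition Re_form (u : ext C 9) : ext R 9 := [ffun A : {set 'I_9} => complex.Re (u A)].
Definition Im_form (u : ext C 9) : ext R 9 := [ffun A : {set 'I_9} => complex.Im (u A)].

Definition eta : 'M[ext C 9]_3 :=
  let sigma : ext C 9 := coframe C 1 + 'i%C *: coframe C 2 in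
  let mu    : ext C 9 := coframe C 3 + 'i%C *: coframe C 4 in
  let nu    : ext C 9 := coframe C 5 + 'i%C *: coframe C 6 in
  let kappa : ext C 9 := coframe C 7 in
  let zeta  : ext C 9 := coframe C 8 in
  mx3 [:: [:: 'i%C *: (zeta + kappa); nu; sigma];
          [:: - conj_form nu; 'i%C *: (zeta - kappa); mu];
          [:: - conj_form sigma; - conj_form mu; - (2 * 'i%C) *: zeta]].

(* The Maurer-Cartan equation d eta = - eta /\ eta. *)
Definition deta : 'M[ext C 9]_3 := - mxwedge eta eta.

(* Exterior derivatives of the coframe, read off from the entries of [deta]. *)
Definition dcoframe (i : 'I_9) : ext R 9 :=
  [:: 0;
      Re_form (deta 0 2); Im_form (deta 0 2);
      Re_form (deta 1 2); Im_form (deta 1 2);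
      Re_form (deta 0 1); Im_form (deta 0 1);
      2^-1 *: Im_form (deta 0 0 - deta 1 1);
      - 2^-1 *: Im_form (deta 2 2)]`_i.

(* The second sum is the antiderivation sending each th^i to d th^i. *)
Definition dform (u : R -> ext R 9) (r : R) : ext R 9 :=
  wedge (coframe R 0) [ffun A : {set 'I_9} => (fun s => u s A : R)^`()%classic r]
  + \sum_i wedge (dcoframe i) (contract i (u r)).

End MaurerCartan.

Section Calabi.
Variable R : realType.
Implicit Types r : R.

(* e^i = calabi_scale r i th^i for i < 8. *)
Definition calabi_scale r (i : 'I_9) : R :=
  let a := Num.sqrt ((r ^+ 2 - 1) / 2) in
  let b := Num.sqrt ((r ^+ 2 + 1) / 2) in
  let c := r in
  let f := r^-1 * Num.sqrt (r ^+ 4 - 1) in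
  [:: Num.sqrt (r ^+ 4 / (r ^+ 4 - 1)); a; a; b; b; c; c; f]`_i.

Definition horizontal : {set 'I_9} := [set i : 'I_9 | (i < 8)%N].

(* hodge (e^A) = shuffle_sign A A^c e^{A^c}, with A^c = {0, ..., 7} \ A, for the
   metric sum_j (e^j)^2 and the orientation e^{01234567}.  Only meaningful on
   forms without zeta component; curvatures of the connections below are such,
   because d kappa, d nu_1 and d nu_2 are. *)
Definition hodge r (u : ext R 9) : ext R 9 :=
  [ffun B : {set 'I_9} =>
     if B \subset horizontal then
       let A := horizontal :\: B in
       shuffle_sign R A B * (\prod_(i in B) calabi_scale r i)
         * (u A / \prod_(i in A) calabi_scale r i)
     else 0].

Definition calabi_e r (i : 'I_9) : ext R 9 :=
  calabi_scale r i *: monomial R [set i].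

Definition calabi_e2 r (i j : 'I_9) : ext R 9 :=
  wedge (calabi_e r i) (calabi_e r j).

Local Notation e2 r i j :=
  (calabi_e2 r (@Ordinal 9 i isT) (@Ordinal 9 j isT)).

Definition omega_I r : ext R 9 := - e2 r 0 7 + e2 r 5 6 + e2 r 1 2 - e2 r 3 4.
Definition omega_J r : ext R 9 := - e2 r 0 6 - e2 r 5 7 - e2 r 2 3 + e2 r 1 4.
Definition omega_K r : ext R 9 := e2 r 0 5 - e2 r 6 7 + e2 r 2 4 + e2 r 1 3.

End Calabi.

Section Connections.
Variable R : realType.

Definition so3_T1 : 'M[R]_3 :=
  mx3 [:: [:: 0; 0; 0]; [:: 0; 0; -1]; [:: 0; 1; 0]].
Definition so3_T2 : 'M[R]_3 :=
  mx3 [:: [:: 0; 0; 1]; [:: 0; 0; 0]; [:: -1; 0; 0]].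
Definition so3_T3 : 'M[R]_3 :=
  mx3 [:: [:: 0; -1; 0]; [:: 1; 0; 0]; [:: 0; 0; 0]].

Definition tensor (alpha : ext R 9) (T : 'M[R]_3) : 'M[ext R 9]_3 :=
  map_mx (fun x => x *: alpha) T.

Definition inv_connection (p0 p1 p2 q0 q1 q2 s0 s1 s2 : R -> R) (r : R) :
    'M[ext R 9]_3 :=
  let nu1   : ext R 9 := coframe R 5 in
  let nu2   : ext R 9 := coframe R 6 in
  let kappa : ext R 9 := coframe R 7 in
  tensor (p0 r *: kappa + p1 r *: nu1 + p2 r *: nu2) so3_T1
  + tensor (q0 r *: kappa + q1 r *: nu1 + q2 r *: nu2) so3_T2
  + tensor (s0 r *: kappa + s1 r *: nu1 + s2 r *: nu2) so3_T3.

(* F_A = dA + A /\ A = dA + (1/2) [A /\ A]. *)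
Definition curvature (A : R -> 'M[ext R 9]_3) (r : R) : 'M[ext R 9]_3 :=
  (\matrix_(i, j) dform (fun s => A s i j) r) + mxwedge (A r) (A r).

Definition su4_instanton (omega : R -> ext R 9) (A : R -> 'M[ext R 9]_3) :=
  forall r, 1 < r -> forall i j,
    hodge r (curvature A r i j) =
    - 2^-1 *: wedge (wedge (omega r) (omega r)) (curvature A r i j).

Definition smooth_gt1 (f : R -> R) :=
  forall (n : nat) (r : R), 1 < r -> derivable (f^`(n)%classic) r 1.

End Connections.

(* Main.v *)
(* A = M0 kappa + M1 nu_1 + M2 nu_2 for so(3)-valued functions M0, M1, M2 of r.
   The L-SU(4) equation says that F_A is of type (1,1) and primitive with respect
   to omega_L.  Type (1,1) is an algebraic condition on the components of F_A in
   the sigma and mu directions, which only involve the undifferentiated M_k: it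
   forces two of the M_k to vanish.  All brackets [M_i, M_j] then vanish too, and
   primitivity becomes a scalar linear equation (g M)' = 0 for each entry of the
   remaining M, with g = r^2 (1 - r^4) for L = I and g = (r^4 - 1)^(3/2) for
   L = J, K. *)
Require Import Defs.
From mathcomp Require Import all_boot all_order all_algebra.
From mathcomp Require Import complex ring lra.
From mathcomp Require Import all_classical all_reals all_analysis.
Import Order.TTheory GRing.Theory Num.Theory.
Import numFieldNormedType.Exports.
Local Open Scope ring_scope.

(** * Exterior algebra on monomials *)

(** In complex dimension four, following F -> -1/2 omega^2 /\ F by the Hodge star gives an operator
    on two-forms that is 1 on primitive (1,1)-forms, -1 on types (2,0) and (0,2), and -3 on
    multiples of omega; hence the meaning of the equation. This decomposition is not developed here:
    the six-forms on the two sides are compared coefficient by coefficient. The obstacle is that a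
    form is a function on the 512 subsets of nine indices, which does not reduce by computation.
    Coefficient lists do reduce, and every identity becomes a finite system for [ring], [field] or
    [lra]. The scale 1 suits the structure equations; [calabi_scale] gives the Kahler forms and the
    Hodge star constant coefficients. Two of the M_k vanish because the signs in d kappa, d nu_1, d
    nu_2 clash with those of type (1,1). The weights g come from the trace condition, which
    prescribes M'/M as -2/r - 4r^3/(r^4-1) for I and as -6r^3/(r^4-1) for J and K. *)

Section ExteriorMonomials.
Context {K : comNzRingType} {n : nat}.
Implicit Types (u v w : ext K n) (A B : {set 'I_n}).

Lemma wedge_suml (I : Type) (l : seq I) (F : I -> ext K n) v :
  wedge (\sum_(x <- l) F x) v = \sum_(x <- l) wedge (F x) v.
Proof.
apply/ffunP => A; rewrite ffunE sum_ffunE.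
under [RHS]eq_bigr do rewrite ffunE.
rewrite exchange_big; apply: eq_bigr => B _ /=.
by rewrite sum_ffunE mulr_sumr mulr_suml.
Qed.

Lemma wedge_sumr (I : Type) (l : seq I) (F : I -> ext K n) u :
  wedge u (\sum_(x <- l) F x) = \sum_(x <- l) wedge u (F x).
Proof.
apply/ffunP => A; rewrite ffunE sum_ffunE.
under [RHS]eq_bigr do rewrite ffunE.
rewrite exchange_big; apply: eq_bigr => B _ /=.
by rewrite sum_ffunE mulr_sumr.
Qed.

Lemma wedgeZl (k : K) u v : wedge (k *: u) v = k *: wedge u v.
Proof.
apply/ffunP => A; rewrite !ffunE /GRing.scale /= mulr_sumr.
by apply: eq_bigr => B _; rewrite ffunE /GRing.scale /= mulrCA !mulrA.
Qed.

Lemma wedgeZr (k : K) u v : wedge u (k *: v) = k *: wedge u v.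
Proof.
apply/ffunP => A; rewrite !ffunE /GRing.scale /= mulr_sumr.
by apply: eq_bigr => B _; rewrite ffunE /GRing.scale /= [RHS]mulrCA.
Qed.

Lemma wedge_monomial A B :
  wedge (monomial K A) (monomial K B) =
  if [disjoint A & B] then shuffle_sign K A B *: monomial K (A :|: B) else 0.
Proof.
apply/ffunP => C; rewrite ffunE.
(* The first monomial kills every term of the sum except the one at [A]; the second then forces
   [C :\: A] to be [B]. *)
transitivity (\sum_(D : {set 'I_n} | (D \subset C) && (D == A))
   shuffle_sign K A (C :\: A) * (C :\: A == B)%:R).
  rewrite big_mkcondr; apply: eq_bigr => D _; rewrite !ffunE.
  by case: eqP => [->|_]; rewrite ?mulr1 // mulr0 mul0r.
have [AC|nAC] := boolP (A \subset C); last first.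
  rewrite big_pred0; last by move=> D; case: eqP => [->|]; rewrite ?(negPf nAC) ?andbF.
  case: ifP; rewrite !ffunE // => _; case: eqP => [e|_]; rewrite ?scaler0 //.
  by rewrite e finset.subsetUl in nAC.
rewrite (big_pred1 A); last by move=> D /=; case: eqP => [->|]; rewrite ?AC ?andbF.
have AC' : A :|: C :\: A = C by rewrite -{1}(finset.setIidPr AC) finset.setID.
have [<-|neq] := eqVneq (C :\: A) B.
  by rewrite finset.disjoints_subset finset.setCD finset.subsetUr !ffunE AC' eqxx.
rewrite mulr0; case: ifP; rewrite !ffunE // => dis.
case: eqP => [e|_]; rewrite ?scaler0 //.
by rewrite e finset.setDUl finset.setDv finset.set0U (finset.setDidPl _) ?eqxx // disjoint_sym in neq.
Qed.

(** The empty monomial is the unit; it lets a bare two-form be written as a wedge product in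
    [dform1]. *)
Lemma wedge_monomial0 u : wedge u (monomial K finset.set0) = u.
Proof.
apply/ffunP => A; rewrite ffunE (bigD1 A) //= big1 ?addr0 => [|B /andP[BA nBA]].
  rewrite ffunE finset.setDv eqxx mulr1 /shuffle_sign big1 ?mul1r // => i _.
  by apply/eqP; rewrite cards_eq0; apply/eqP/setP => j; rewrite !inE.
rewrite ffunE finset.setD_eq0; case: (boolP (A \subset B)) => [AB|]; last by rewrite mulr0.
by rewrite finset.eqEsubset BA AB in nBA.
Qed.

Lemma contract_monomial1 (i j : 'I_n) :
  Defs.contract i (monomial K [set j]) = (i == j)%:R *: monomial K finset.set0.
Proof.
apply/ffunP => A; rewrite !ffunE.
have [iA|iA] := boolP (i \in A).
  case: (A =P finset.set0) => [A0|]; first by rewrite A0 inE in iA.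
  by rewrite scaler0.
have [A0|/finset.set0Pn[k kA]] := eqVneq A finset.set0.
  have -> : shuffle_sign K [set i] A = 1.
    rewrite A0 /shuffle_sign big1 // => k _; apply/eqP; rewrite cards_eq0.
    by apply/eqP/setP => l; rewrite !inE.
  by rewrite A0 finset.setU0 (inj_eq set1_inj) mul1r /GRing.scale /= mulr1.
rewrite scaler0; case: eqP => [e|_]; last by rewrite mulr0.
have: k \in [set j] by rewrite -e !inE kA orbT.
have: i \in [set j] by rewrite -e !inE eqxx.
by rewrite !inE => /eqP ij /eqP kj; rewrite ij -kj kA in iA.
Qed.
End ExteriorMonomials.

(** * Computing with forms as coefficient lists *)

(* A form is encoded as a list of pairs (s, x), where s is the increasing
   sequence of the indices of a monomial, and g rescales the generators. *)
Section Encoding.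
Context {K : comNzRingType} {n : nat}.
Variable g : 'I_n -> K.
Implicit Types (s t : seq nat) (l : seq (seq nat * K)).

Definition index_set s : {set 'I_n} := [set i : 'I_n | (i : nat) \in s].

Definition scaled_monomial (A : {set 'I_n}) : ext K n :=
  (\prod_(i in A) g i) *: monomial K A.

Definition form_of l : ext K n :=
  \sum_(x <- l) x.2 *: scaled_monomial (index_set x.1).

(** Filtering [iota 0 n] makes the result sorted and duplicate-free for arbitrary [s] and [t], so
    the comparison with sets needs no side condition. The same holds for the two functions below. *)
Definition union_seq s t := [seq i <- iota 0 n | (i \in s) || (i \in t)].
Definition disjoint_seq s t := ~~ has (fun i => (i \in s) && (i \in t)) (iota 0 n).
Definition inversions s t :=
  sumn [seq count (fun j => (j \in t) && (j < i)%N) (iota 0 n)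
       | i <- iota 0 n & i \in s].
(** A conditional in place of a power of -1, so that concrete signs disappear by simplification. *)
Definition signed (b : bool) (x : K) := if b then - x else x.

Definition wedge_code l1 l2 :=
  [seq (union_seq x.1 y.1, signed (odd (inversions x.1 y.1)) (x.2 * y.2))
  | x <- l1, y <- [seq y <- l2 | disjoint_seq x.1 y.1]].

Lemma signedE b x : signed b x = (-1) ^+ b * x.
Proof. by case: b; rewrite ?expr0 ?mul1r // expr1 mulN1r. Qed.

Lemma index_setU s t : index_set (union_seq s t) = index_set s :|: index_set t.
Proof. by apply/setP => i; rewrite !inE mem_filter mem_iota /= ltn_ord andbT. Qed.

Lemma disjoint_seqE s t : [disjoint index_set s & index_set t] = disjoint_seq s t.
Proof.
apply/pred0P/hasPn => [dis i|dis i].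
  rewrite mem_iota => /= lt_in; have := dis (Ordinal lt_in).
  by rewrite !inE /= => ->.
by have := dis i; rewrite mem_iota /= ltn_ord !inE => /(_ isT)/negPf.
Qed.

Lemma inversionsE s t :
  shuffle_sign K (index_set s) (index_set t) = (-1) ^+ odd (inversions s t).
Proof.
have iotaE : iota 0 n = index_iota 0 n by rewrite /index_iota subn0.
rewrite signr_odd /shuffle_sign /inversions sumnE big_map big_filter.
rewrite iotaE big_mkord; congr (_ ^+ _).
apply: eq_big => i; first by rewrite inE.
move=> _; rewrite -sum1_card -sum1_count.
rewrite big_mkord; apply: eq_bigl => j.
by rewrite !inE.
Qed.

Lemma wedge_scaled (A B : {set 'I_n}) :
  wedge (scaled_monomial A) (scaled_monomial B) =
  if [disjoint A & B] then shuffle_sign K A B *: scaled_monomial (A :|: B) else 0.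
Proof.
rewrite /scaled_monomial wedgeZl wedgeZr wedge_monomial scalerA.
case: ifP => [dis|_]; last by rewrite scaler0.
rewrite !scalerA; congr (_ *: _).
rewrite [in RHS](eq_bigl [predU A & B]) => [|i]; last exact: finset.in_setU.
by rewrite bigU //= mulrC.
Qed.

Lemma wedge_form_of l1 l2 :
  wedge (form_of l1) (form_of l2) = form_of (wedge_code l1 l2).
Proof.
rewrite /form_of wedge_suml [RHS]big_allpairs_dep; apply: eq_bigr => x _.
rewrite wedgeZl wedge_sumr scaler_sumr big_filter [RHS]big_mkcond.
apply: eq_bigr => y _; rewrite wedgeZr wedge_scaled disjoint_seqE.
case: ifP => _; last by rewrite !scaler0.
by rewrite index_setU /= signedE inversionsE !scalerA [(-1) ^+ _ * _]mulrC.
Qed.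

Lemma form_of_cat l1 l2 : form_of (l1 ++ l2) = form_of l1 + form_of l2.
Proof. exact: big_cat. Qed.

Lemma form_ofZ (k : K) l : k *: form_of l = form_of [seq (x.1, k * x.2) | x <- l].
Proof.
by rewrite /form_of big_map scaler_sumr; apply: eq_bigr => x _; rewrite scalerA.
Qed.

Lemma form_ofN l : - form_of l = form_of [seq (x.1, - x.2) | x <- l].
Proof.
by rewrite /form_of big_map -sumrN; apply: eq_bigr => x _; rewrite scaleNr.
Qed.

(** Canonical keys: among these, distinct sequences denote distinct monomials. *)
Definition sorted_index s := s == [seq i <- iota 0 n | i \in s].

Definition coef_at s l := foldr (fun x c => if x.1 == s then x.2 + c else c) 0 l.

Definition coefs_vanish (keys : seq (seq nat)) l :=
  foldr (fun s P => coef_at s l = 0 /\ P) True keys.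

Lemma index_set_inj s t :
  sorted_index s -> sorted_index t -> index_set s = index_set t -> s = t.
Proof.
move=> /eqP-> /eqP-> /setP st; apply: eq_in_filter => i.
rewrite mem_iota /= => lt_in; have := st (Ordinal lt_in).
by rewrite !inE !mem_filter mem_iota lt_in !andbT.
Qed.

Lemma form_of_at l s : all sorted_index (map fst l) -> sorted_index s ->
  form_of l (index_set s) = coef_at s l * \prod_(i in index_set s) g i.
Proof.
move=> canl cans; rewrite /form_of sum_ffunE.
elim: l canl => [|x l IH] /=; first by rewrite big_nil mul0r.
case/andP => canx /IH {}IH; rewrite big_cons IH !ffunE.
case: eqP => [e|ne].
  rewrite (index_set_inj _ _ canx cans) ?eqxx //.
  by rewrite mulrDl /GRing.scale /= mulr1 e.
case: eqP => [e|_]; first by rewrite e in ne.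
by rewrite !scaler0 add0r.
Qed.

End Encoding.

(** Monomials are linearly independent and nonzero scales can be cancelled. For concrete keys the
    right-hand side unfolds to a conjunction of scalar equations, which is how statements about
    forms reach the arithmetic tactics. Repeated keys in [l] are harmless, since [coef_at] adds them
    up. *)
Lemma coefs_vanishP (K : fieldType) n (g : 'I_n -> K) (keys : seq (seq nat)) l :
  all (sorted_index (n := n)) keys ->
  all (fun s => \prod_(i in index_set (n := n) s) g i != 0) keys ->
  all (fun s => s \in keys) (map fst l) ->
  form_of g l = 0 <-> coefs_vanish keys l.
Proof.
move=> cank nzk lk.
have canl : all (sorted_index (n := n)) (map fst l).
  by apply/allP => s /(allP lk) /(allP cank).
split=> [dl0|].
  elim: (keys) {lk} cank nzk => //= s ks IH /andP[cs /IH{}IH] /andP[nz /IH{}IH].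
  split=> //; apply/eqP; rewrite -(mulIr_eq0 _ (mulIf nz)) -form_of_at //.
  by rewrite dl0 ffunE.
move=> H; have {}H s : s \in keys -> coef_at s l = 0.
  elim: (keys) H => //= t ks IH [ct /IH{}IH].
  by rewrite inE => /orP[/eqP->|].
apply/ffunP => A; rewrite ffunE.
have [/hasP[s sk /eqP->]|no] := boolP (has (fun s => A == index_set s) keys).
  by rewrite form_of_at ?H ?mul0r //; apply: (allP cank).
rewrite /form_of sum_ffunE big1_seq // => x /andP[_ xl]; rewrite !ffunE.
case: eqP => [e|_]; last by rewrite !scaler0.
case/negP: no; apply/hasP; exists x.1; last exact/eqP.
by apply: (allP lk); apply: map_f.
Qed.

Lemma form_of_eqP (K : fieldType) n (g : 'I_n -> K) (keys : seq (seq nat)) l1 l2 :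
  all (sorted_index (n := n)) keys ->
  all (fun s => \prod_(i in index_set (n := n) s) g i != 0) keys ->
  all (fun s => s \in keys) (map fst (l1 ++ l2)) ->
  form_of g l1 = form_of g l2 <->
  coefs_vanish keys (l1 ++ [seq (x.1, - x.2) | x <- l2]).
Proof.
move=> cank nzk lk; rewrite -(coefs_vanishP _ _ g keys) //; last first.
  by rewrite map_cat -map_comp -map_cat.
by rewrite form_of_cat -form_ofN; split=> [->|/eqP]; rewrite ?subrr // subr_eq0 => /eqP.
Qed.

(** * Kahler forms and Hodge star *)

Section CalabiForms.
Context {R : realType}.
Implicit Types (r : R) (l : seq (seq nat * R)).

Lemma monomial_form_of (K : comNzRingType) (i : 'I_9) :
  monomial K [set i] = form_of (fun=> 1) [:: ([:: val i], 1)].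
Proof.
rewrite /form_of big_seq1 scale1r /scaled_monomial big1 // scale1r.
by congr monomial; apply/setP => j; rewrite !inE.
Qed.

Lemma calabi_e_form_of r (i : 'I_9) :
  calabi_e r i = form_of (calabi_scale r) [:: ([:: val i], 1)].
Proof.
rewrite /form_of big_seq1 scale1r /scaled_monomial /calabi_e.
have -> : index_set [:: val i] = [set i] by apply/setP => j; rewrite !inE.
by rewrite big_set1.
Qed.

Lemma omega_I_form_of r : omega_I r = form_of (calabi_scale r)
  [:: ([:: 0; 7]%N, -1); ([:: 5; 6]%N, 1); ([:: 1; 2]%N, 1); ([:: 3; 4]%N, -1)].
Proof.
rewrite /omega_I /calabi_e2 !calabi_e_form_of !wedge_form_of !form_ofN -!form_of_cat.
by rewrite /wedge_code /= !mulr1.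
Qed.

Lemma omega_J_form_of r : omega_J r = form_of (calabi_scale r)
  [:: ([:: 0; 6]%N, -1); ([:: 5; 7]%N, -1); ([:: 2; 3]%N, -1); ([:: 1; 4]%N, 1)].
Proof.
rewrite /omega_J /calabi_e2 !calabi_e_form_of !wedge_form_of !form_ofN -!form_of_cat.
by rewrite /wedge_code /= !mulr1.
Qed.

Lemma omega_K_form_of r : omega_K r = form_of (calabi_scale r)
  [:: ([:: 0; 5]%N, 1); ([:: 6; 7]%N, -1); ([:: 2; 4]%N, 1); ([:: 1; 3]%N, 1)].
Proof.
rewrite /omega_K /calabi_e2 !calabi_e_form_of !wedge_form_of form_ofN -!form_of_cat.
by rewrite /wedge_code /= !mulr1.
Qed.

Definition complement (s : seq nat) := [seq i <- iota 0 8 | i \notin s].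

Definition hodge_code l :=
  [seq (complement x.1,
        signed (odd (inversions (n := 9) x.1 (complement x.1))) x.2) | x <- l].

Lemma hodge_sum r (I : Type) (t : seq I) (F : I -> ext R 9) :
  hodge r (\sum_(x <- t) F x) = \sum_(x <- t) hodge r (F x).
Proof.
apply/ffunP => B; rewrite ffunE !sum_ffunE.
under [RHS]eq_bigr do rewrite ffunE.
case: ifP => _; last by rewrite big1.
by rewrite /= sum_ffunE mulr_suml mulr_sumr.
Qed.

Lemma hodgeZ r (k : R) (u : ext R 9) : hodge r (k *: u) = k *: hodge r u.
Proof.
apply/ffunP => B; rewrite !ffunE /GRing.scale /= !ffunE /GRing.scale /=.
by case: ifP => _; rewrite ?mulr0 //= -(mulrA k) mulrCA.
Qed.

(** In the orthonormal coframe the two scale products in [hodge] cancel against those in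
    [scaled_monomial]; only the shuffle sign remains. *)
Lemma hodge_form_of r l :
  (forall i, i \in horizontal -> calabi_scale r i != 0) ->
  all (fun x => all (fun i => i < 8)%N x.1) l ->
  hodge r (form_of (calabi_scale r) l) = form_of (calabi_scale r) (hodge_code l).
Proof.
move=> nz hor; rewrite /form_of hodge_sum big_map; apply: eq_big_seq => x xl.
rewrite hodgeZ /= signedE mulrC -scalerA; congr (_ *: _).
have xhor : index_set x.1 \subset horizontal.
  apply/fintype.subsetP => i; rewrite !inE => ix.
  by have /allP/(_ _ ix) := allP hor _ xl.
have cE : index_set (complement x.1) = horizontal :\: index_set x.1.
  by apply/setP => i; rewrite !inE mem_filter mem_iota.
rewrite -inversionsE cE; set A := index_set x.1.
apply/ffunP => B; rewrite !ffunE /GRing.scale /= ?ffunE /GRing.scale /= ?ffunE.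
case: (boolP (B \subset horizontal)) => [BH|nBH]; last first.
  case: eqP => [e|_]; last by rewrite !mulr0.
  by rewrite e finset.subsetDl in nBH.
have [<-|ne] := eqVneq (horizontal :\: B) A.
  rewrite finset.setDDr finset.setDv finset.set0U (finset.setIidPr BH) eqxx !mulr1 mulfV ?mulr1 //.
  by apply/prodf_neq0 => i /finset.setDP[iH _]; apply: nz.
rewrite !(mulr0, mul0r); case: eqP => [e|_]; last by rewrite !mulr0.
by rewrite e finset.setDDr finset.setDv finset.set0U (finset.setIidPr xhor) eqxx in ne.
Qed.

End CalabiForms.

(** * Structure equations and curvature *)

Section StructureEquations.
Context {R : realType}.
Local Notation C := R[i].

Lemma form_of1E (K : comNzRingType) (l : seq (seq nat * K)) (A : {set 'I_9}) :
  form_of (fun=> 1) l A = \sum_(x <- l) x.2 *+ (A == index_set x.1).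
Proof.
rewrite /form_of sum_ffunE; apply: eq_bigr => x _.
by rewrite !ffunE big1 // /GRing.scale /= mul1r mulr_natr.
Qed.

(** With unit scale each value of the form is a sum of list coefficients, so any additive map, such
    as conjugation or a real or imaginary part, acts on the list. *)
Lemma map_form_of1 (K L : comNzRingType) (f : K -> L) (l : seq (seq nat * K)) :
  f 0 = 0 -> {morph f : x y / x + y} ->
  [ffun A : {set 'I_9} => f (form_of (fun=> 1) l A)] =
  form_of (fun=> 1) [seq (x.1, f x.2) | x <- l].
Proof.
move=> f0 fD; apply/ffunP => A; rewrite ffunE !form_of1E big_map (big_morph f fD f0).
by apply: eq_bigr => x _; case: (_ == _); rewrite ?f0.
Qed.

Lemma conj_form_of (l : seq (seq nat * C)) :
  conj_form (form_of (fun=> 1) l) = form_of (fun=> 1) [seq (x.1, (x.2)^*%C) | x <- l].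
Proof. by rewrite -map_form_of1 // => [|x y]; rewrite ?rmorph0 ?rmorphD. Qed.

Lemma Re_form_of (l : seq (seq nat * C)) :
  Re_form (form_of (fun=> 1) l) = form_of (fun=> 1) [seq (x.1, complex.Re x.2) | x <- l].
Proof. by rewrite -map_form_of1 // => -[? ?] [? ?]. Qed.

Lemma Im_form_of (l : seq (seq nat * C)) :
  Im_form (form_of (fun=> 1) l) = form_of (fun=> 1) [seq (x.1, complex.Im x.2) | x <- l].
Proof. by rewrite -map_form_of1 // => -[? ?] [? ?]. Qed.

Lemma form_of1_eqP (K : fieldType) (keys : seq (seq nat)) (l1 l2 : seq (seq nat * K)) :
  all (sorted_index (n := 9)) keys ->
  all (fun s => s \in keys) (map fst (l1 ++ l2)) ->
  form_of (fun _ : 'I_9 => 1) l1 = form_of (fun=> 1) l2 <->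
  coefs_vanish keys (l1 ++ [seq (x.1, - x.2) | x <- l2]).
Proof.
move=> ck lk; apply: form_of_eqP => //; apply/allP => s _.
by rewrite big1 // oner_neq0.
Qed.

Lemma mxwedge_form_of (K : comNzRingType) n (g : 'I_n -> K)
    (c d : 'I_3 -> 'I_3 -> seq (seq nat * K)) i j :
  mxwedge (\matrix_(i, j) form_of g (c i j)) (\matrix_(i, j) form_of g (d i j)) i j =
  form_of g (flatten [seq wedge_code (n := n) (c i k) (d k j) | k <- [:: 0; 1; 2 : 'I_3]]).
Proof.
have e1 : lift ord0 ord0 = 1 :> 'I_3 by apply/val_inj.
have e2 : lift ord0 (lift ord0 ord0) = 2 :> 'I_3 by apply/val_inj.
rewrite mxE !big_ord_recl big_ord0 !mxE !wedge_form_of /= !form_of_cat e1 e2.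
by rewrite [form_of g [::]]big_nil.
Qed.

Definition eta_code (i j : 'I_3) : seq (seq nat * C) :=
  nth [::] (nth [::]
  [:: [:: [:: ([:: 8]%N, 'i%C); ([:: 7]%N, 'i%C)];
          [:: ([:: 5]%N, 1); ([:: 6]%N, 'i%C)];
          [:: ([:: 1]%N, 1); ([:: 2]%N, 'i%C)]];
      [:: [:: ([:: 5]%N, -1); ([:: 6]%N, 'i%C)];
          [:: ([:: 8]%N, 'i%C); ([:: 7]%N, - 'i%C)];
          [:: ([:: 3]%N, 1); ([:: 4]%N, 'i%C)]];
      [:: [:: ([:: 1]%N, -1); ([:: 2]%N, 'i%C)];
          [:: ([:: 3]%N, -1); ([:: 4]%N, 'i%C)];
          [:: ([:: 8]%N, - (2 * 'i%C))]]] i) j.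

Lemma etaE : eta R = \matrix_(i, j) form_of (fun=> 1) (eta_code i j).
Proof.
have c1 : Complex 1 0 = 1 :> C by [].
have ci : Complex 0 (- 1) = - 'i%C :> C by apply/eqP; rewrite eq_complex /= oppr0 !eqxx.
rewrite /eta !monomial_form_of !form_ofN !form_ofZ -!form_of_cat /= !form_ofZ
  !conj_form_of !form_ofN /= !(mul0r, mulr0, mulr1, subr0, add0r, oppr0) mulrN1 c1 ci opprK.
by apply/matrixP => -[[|[|[|//]]] ?] [[|[|[|//]]] ?]; rewrite !mxE.
Qed.

Lemma detaE i j : deta R i j = form_of (fun=> 1)
  [seq (x.1, - x.2)
  | x <- flatten [seq wedge_code (n := 9) (eta_code i k) (eta_code k j)
                 | k <- [:: 0; 1; 2 : 'I_3]]].
Proof. by rewrite mxE etaE mxwedge_form_of form_ofN. Qed.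

Lemma dcoframe_nu1 : dcoframe R (@Ordinal 9 5 isT) = form_of (fun=> 1)
  [:: ([:: 6; 7]%N, - 2); ([:: 1; 3]%N, 1); ([:: 2; 4]%N, 1)].
Proof.
rewrite /dcoframe /= detaE Re_form_of.
(* The keys include monomials whose coefficients cancel. Those with index 8 do so because nu has
   weight 0 under the circle generated by zeta, which is why no zeta component appears in the
   result. *)
apply/(form_of1_eqP _ [:: [:: 1; 3]; [:: 1; 4]; [:: 2; 3]; [:: 2; 4];
  [:: 5; 7]; [:: 5; 8]; [:: 6; 7]; [:: 6; 8]]%N) => //=.
by repeat split; ring.
Qed.

Lemma dcoframe_nu2 : dcoframe R (@Ordinal 9 6 isT) = form_of (fun=> 1)
  [:: ([:: 5; 7]%N, 2); ([:: 2; 3]%N, 1); ([:: 1; 4]%N, -1)].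
Proof.
rewrite /dcoframe /= detaE Im_form_of.
apply/(form_of1_eqP _ [:: [:: 1; 3]; [:: 1; 4]; [:: 2; 3]; [:: 2; 4];
  [:: 5; 7]; [:: 5; 8]; [:: 6; 7]; [:: 6; 8]]%N) => //=.
by repeat split; ring.
Qed.

Lemma dcoframe_kappa : dcoframe R (@Ordinal 9 7 isT) = form_of (fun=> 1)
  [:: ([:: 5; 6]%N, - 2); ([:: 1; 2]%N, -1); ([:: 3; 4]%N, 1)].
Proof.
rewrite /dcoframe /= !detaE form_ofN -form_of_cat Im_form_of form_ofZ.
apply/(form_of1_eqP _ [:: [:: 1; 2]; [:: 3; 4]; [:: 5; 6]; [:: 7; 8]]%N) => //=.
by repeat split; field.
Qed.

End StructureEquations.

(** * Curvature of an invariant connection *)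

Section Curvature.
Context {R : realType}.

(** The Leibniz rule for one-forms. Every coefficient of the form is a single [c k] or zero, so no
    derivative of a sum is ever taken. *)
Lemma dform1 (c : 'I_9 -> R -> R) r :
  dform (fun s => \sum_k c k s *: monomial R [set k]) r =
  \sum_k ((c k)^`()%classic r *: wedge (coframe R 0) (monomial R [set k])
          + c k r *: dcoframe R k).
Proof.
rewrite /dform big_split /=; congr (_ + _).
  under [RHS]eq_bigr do rewrite -wedgeZr.
  rewrite -wedge_sumr; congr wedge; apply/ffunP => A; rewrite ffunE sum_ffunE.
  have cE s : (\sum_k c k s *: monomial R [set k]) A =
      \sum_(k | A == [set k]) c k s.
    rewrite sum_ffunE [RHS]big_mkcond; apply: eq_bigr => k _.
    by rewrite !ffunE /GRing.scale /=; case: eqP => _; rewrite ?mulr1 ?mulr0.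
  under eq_fun do rewrite cE.
  transitivity (\sum_(k | A == [set k]) (c k)^`()%classic r); last first.
    rewrite big_mkcond; apply: eq_bigr => k _.
    by rewrite !ffunE /GRing.scale /=; case: eqP => _; rewrite ?mulr1 ?mulr0.
  have [/existsP[k /eqP Ak]|no] := boolP [exists k, A == [set k]].
    have P j : (A == [set j]) = (j == k) by rewrite Ak (inj_eq set1_inj) eq_sym.
    rewrite (big_pred1 k) //; congr (_^`()%classic r); apply/funext => s.
    exact: big_pred1.
  have P j : (A == [set j]) = false by apply/negP => Aj; case/existsP: no; exists j.
  rewrite big_pred0 //; under eq_fun do rewrite big_pred0 //.
  exact: derive1_cst.
(* Multiplying by the unit puts both sides in the shape of a wedge with [dcoframe]; it remains to
   see that contracting the one-form with index [i] gives the scalar [c i r]. *)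
under [RHS]eq_bigr do rewrite -[dcoframe R _]wedge_monomial0 -wedgeZr.
apply: eq_bigr => i _; congr wedge.
apply/ffunP => A.
transitivity ((\sum_k c k r *: Defs.contract i (monomial R [set k])) A).
  rewrite !ffunE !sum_ffunE; case: ifP => iA.
    by rewrite big1 // => k _; rewrite !ffunE iA /GRing.scale /= mulr0.
  rewrite mulr_sumr; apply: eq_bigr => k _.
  by rewrite !ffunE iA /GRing.scale /= mulrCA.
congr (fun_of_fin _ A); rewrite (bigD1 i) //= big1 => [|k ki].
  by rewrite contract_monomial1 eqxx scale1r addr0.
by rewrite contract_monomial1 eq_sym (negPf ki) scale0r scaler0.
Qed.

(** The nine scalar functions are grouped by coframe element rather than by basis vector of so(3),
    so that each argument treats three matrices. *)
Definition connection_of (M0 M1 M2 : R -> 'M[R]_3) (r : R) : 'M[ext R 9]_3 :=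
  \matrix_(i, j) (M0 r i j *: coframe R 7 + M1 r i j *: coframe R 5
                  + M2 r i j *: coframe R 6).

Definition entry_derive (M : R -> 'M[R]_3) (r : R) : 'M[R]_3 :=
  \matrix_(i, j) (fun s => M s i j)^`()%classic r.

Definition bracket (M N : 'M[R]_3) := M *m N - N *m M.

(** The derivatives of the M_k give the components with index 0, and A /\ A gives the brackets. The
    components in the sigma and mu directions come only from d kappa, d nu_1 and d nu_2. *)
Lemma curvature_connection_of (M0 M1 M2 : R -> 'M[R]_3) r i j :
  curvature (connection_of M0 M1 M2) r i j = form_of (fun=> 1)
  [:: ([:: 0; 7]%N, entry_derive M0 r i j);
      ([:: 0; 5]%N, entry_derive M1 r i j);
      ([:: 0; 6]%N, entry_derive M2 r i j);
      ([:: 5; 6]%N, bracket (M1 r) (M2 r) i j - 2 * M0 r i j);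
      ([:: 5; 7]%N, - bracket (M0 r) (M1 r) i j + 2 * M2 r i j);
      ([:: 6; 7]%N, - bracket (M0 r) (M2 r) i j - 2 * M1 r i j);
      ([:: 1; 2]%N, - M0 r i j);
      ([:: 3; 4]%N, M0 r i j);
      ([:: 1; 3]%N, M1 r i j);
      ([:: 2; 4]%N, M1 r i j);
      ([:: 2; 3]%N, M2 r i j);
      ([:: 1; 4]%N, - M2 r i j)].
Proof.
have dA : dform (fun s => connection_of M0 M1 M2 s i j) r = form_of (fun=> 1)
  [:: ([:: 0; 7]%N, entry_derive M0 r i j);
      ([:: 0; 5]%N, entry_derive M1 r i j);
      ([:: 0; 6]%N, entry_derive M2 r i j);
      ([:: 5; 6]%N, - 2 * M0 r i j);
      ([:: 5; 7]%N, 2 * M2 r i j);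
      ([:: 6; 7]%N, - 2 * M1 r i j);
      ([:: 1; 2]%N, - M0 r i j);
      ([:: 3; 4]%N, M0 r i j);
      ([:: 1; 3]%N, M1 r i j);
      ([:: 2; 4]%N, M1 r i j);
      ([:: 2; 3]%N, M2 r i j);
      ([:: 1; 4]%N, - M2 r i j)].
  pose c (k : 'I_9) s : R := [:: 0; 0; 0; 0; 0; M1 s i j; M2 s i j; M0 s i j; 0]`_k.
  (* Only the indices of nu_1, nu_2 and kappa contribute to the sum given by [dform1]. *)
  have big567 (F : 'I_9 -> ext R 9) :
      (forall k : 'I_9, (k : nat) \notin [:: 5; 6; 7]%N -> F k = 0) ->
      \sum_k F k = F (@Ordinal 9 5 isT) + F (@Ordinal 9 6 isT) + F (@Ordinal 9 7 isT).
    move=> F0; rewrite (bigD1 (@Ordinal 9 5 isT)) //= (bigD1 (@Ordinal 9 6 isT)) //=.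
    rewrite (bigD1 (@Ordinal 9 7 isT)) //= big1 ?addr0 ?addrA // => k.
    by rewrite -!val_eqE /= => k567; apply: F0; rewrite !inE !negb_or andbA.
  have c0 (k : 'I_9) : (k : nat) \notin [:: 5; 6; 7]%N -> c k = cst 0.
    by case: k => -[|[|[|[|[|[|[|[|[|]]]]]]]]].
  have cE s : connection_of M0 M1 M2 s i j = \sum_k c k s *: monomial R [set k].
    rewrite big567 => [|k /c0->]; last by rewrite scale0r.
    by rewrite mxE -addrA addrC.
  under eq_fun do rewrite cE.
  rewrite dform1 big567 => [|k /c0->]; last by rewrite derive1_cst !scale0r addr0.
  rewrite dcoframe_nu1 dcoframe_nu2 dcoframe_kappa !monomial_form_of !wedge_form_of.
  rewrite !form_ofZ -!form_of_cat.
  apply/(form_of1_eqP _ [:: [:: 0; 7]; [:: 0; 5]; [:: 0; 6]; [:: 5; 6]; [:: 5; 7];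
    [:: 6; 7]; [:: 1; 2]; [:: 3; 4]; [:: 1; 3]; [:: 2; 4]; [:: 2; 3]; [:: 1; 4]]%N) => //=.
  rewrite /c /entry_derive !mxE /=.
  by repeat split; ring.
rewrite mxE [X in X + _]mxE dA.
pose A_code i j := [:: ([:: 7]%N, M0 r i j); ([:: 5]%N, M1 r i j); ([:: 6]%N, M2 r i j)].
have -> : connection_of M0 M1 M2 r = \matrix_(i, j) form_of (fun=> 1) (A_code i j).
  by apply/matrixP => k l; rewrite !mxE !monomial_form_of !form_ofZ -!form_of_cat /= !mulr1.
rewrite mxwedge_form_of -form_of_cat.
apply/(form_of1_eqP _ [:: [:: 0; 7]; [:: 0; 5]; [:: 0; 6]; [:: 5; 6]; [:: 5; 7];
  [:: 6; 7]; [:: 1; 2]; [:: 3; 4]; [:: 1; 3]; [:: 2; 4]; [:: 2; 3]; [:: 1; 4]]%N) => //=.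
have e1 : lift ord0 ord0 = 1 :> 'I_3 by apply/val_inj.
have e2 : lift ord0 (lift ord0 ord0) = 2 :> 'I_3 by apply/val_inj.
rewrite /bracket !mxE !big_ord_recl !big_ord0 /= !e1 !e2.
by repeat split; ring.
Qed.
End Curvature.

(** * Primitive (1,1)-forms *)

Section PrimitiveTwoForms.
Context {R : realType}.
Variable r : R.
Hypothesis r_gt1 : 1 < r.

Lemma calabi_scale_gt0 (i : 'I_9) : i \in horizontal -> 0 < calabi_scale r i.
Proof.
have r0 : 0 < r by exact: lt_trans r_gt1.
have r2 : 0 < r ^+ 2 - 1 by rewrite subr_gt0 exprn_egt1.
have r2' : 0 < r ^+ 2 + 1 by rewrite addr_gt0 ?exprn_gt0.
have r4 : 0 < r ^+ 4 - 1.
  by rewrite subr_gt0 exprn_egt1.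
by rewrite inE /calabi_scale; case: i => -[|[|[|[|[|[|[|[|[|//]]]]]]]]] // ? _ /=;
  rewrite ?mulr_gt0 ?invr_gt0 ?sqrtr_gt0 ?divr_gt0 ?exprn_gt0 //.
Qed.

Lemma prod_scale (s : seq nat) : sorted_index (n := 9) s ->
  \prod_(i in index_set s) calabi_scale r i = \prod_(k <- s) calabi_scale r (inord k).
Proof.
move=> /eqP e; rewrite [in RHS]e big_filter -[iota 0 9]/(index_iota 0 9) big_mkord.
by apply: eq_big => i; rewrite ?inE ?inord_val.
Qed.

Lemma prod_scale_neq0 (s : seq nat) :
  all (fun i => i < 8)%N s ->
  \prod_(i in index_set s) calabi_scale r i != 0.
Proof.
move=> /allP s8; apply/prodf_neq0 => i; rewrite inE => /s8 i8.
by rewrite gt_eqF // calabi_scale_gt0 // inE.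
Qed.

(** All pairs within {0,5,6,7} and all pairs within {1,2,3,4}, in the order of
    [curvature_connection_of]; mixed pairs never occur in the curvature. *)
Definition two_form_code (x07 x05 x06 x56 x57 x67 x12 x34 x13 x24 x23 x14 : R) :=
  [:: ([:: 0; 7]%N, x07); ([:: 0; 5]%N, x05); ([:: 0; 6]%N, x06);
      ([:: 5; 6]%N, x56); ([:: 5; 7]%N, x57); ([:: 6; 7]%N, x67);
      ([:: 1; 2]%N, x12); ([:: 3; 4]%N, x34); ([:: 1; 3]%N, x13);
      ([:: 2; 4]%N, x24); ([:: 2; 3]%N, x23); ([:: 1; 4]%N, x14)].

(** The Hodge star and the wedge with omega_L^2 both send the twelve monomials of [two_form_code] to
    combinations of their complements. *)
Let six_keys := [seq complement s | s <- [:: [:: 0; 7]; [:: 0; 5]; [:: 0; 6];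
  [:: 5; 6]; [:: 5; 7]; [:: 6; 7]; [:: 1; 2]; [:: 3; 4]; [:: 1; 3]; [:: 2; 4];
  [:: 2; 3]; [:: 1; 4]]%N].

Let six_keys_nz :
  all (fun s => \prod_(i in index_set s) calabi_scale r i != 0) six_keys.
Proof.
apply/allP => s /mapP[t _ ->]; apply: prod_scale_neq0; apply/allP => i.
by rewrite mem_filter mem_iota => /and3P[].
Qed.

(** The first four equations say that the form has type (1,1), two for each block of four indices;
    the last one says that its trace against omega vanishes. [primitive_J] and [primitive_K] have
    the same structure. *)
Lemma primitive_I x07 x05 x06 x56 x57 x67 x12 x34 x13 x24 x23 x14 :
  let F := form_of (calabi_scale r)
    (two_form_code x07 x05 x06 x56 x57 x67 x12 x34 x13 x24 x23 x14) in
  hodge r F = - 2^-1 *: wedge (wedge (omega_I r) (omega_I r)) F <->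
  [/\ x67 = x05, x57 = - x06, x24 = - x13, x14 = x23 & x07 = x56 + x12 - x34].
Proof.
move=> F; rewrite hodge_form_of //; last by move=> i /calabi_scale_gt0/gt_eqF->.
rewrite omega_I_form_of !wedge_form_of form_ofZ.
apply: (iff_trans (form_of_eqP _ _ _ six_keys _ _ _ six_keys_nz _)) => //=.
by split=> [H|[*]]; [split | repeat split]; lra.
Qed.

Lemma primitive_J x07 x05 x06 x56 x57 x67 x12 x34 x13 x24 x23 x14 :
  let F := form_of (calabi_scale r)
    (two_form_code x07 x05 x06 x56 x57 x67 x12 x34 x13 x24 x23 x14) in
  hodge r F = - 2^-1 *: wedge (wedge (omega_J r) (omega_J r)) F <->
  [/\ x67 = x05, x56 = x07, x24 = - x13, x34 = x12 & x06 = - x57 - x23 + x14].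
Proof.
move=> F; rewrite hodge_form_of //; last by move=> i /calabi_scale_gt0/gt_eqF->.
rewrite omega_J_form_of !wedge_form_of form_ofZ.
apply: (iff_trans (form_of_eqP _ _ _ six_keys _ _ _ six_keys_nz _)) => //=.
by split=> [H|[*]]; [split | repeat split]; lra.
Qed.

Lemma primitive_K x07 x05 x06 x56 x57 x67 x12 x34 x13 x24 x23 x14 :
  let F := form_of (calabi_scale r)
    (two_form_code x07 x05 x06 x56 x57 x67 x12 x34 x13 x24 x23 x14) in
  hodge r F = - 2^-1 *: wedge (wedge (omega_K r) (omega_K r)) F <->
  [/\ x57 = - x06, x56 = x07, x14 = x23, x34 = x12 & x05 = x67 - x24 - x13].
Proof.
move=> F; rewrite hodge_form_of //; last by move=> i /calabi_scale_gt0/gt_eqF->.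
rewrite omega_K_form_of !wedge_form_of form_ofZ.
apply: (iff_trans (form_of_eqP _ _ _ six_keys _ _ _ six_keys_nz _)) => //=.
by split=> [H|[*]]; [split | repeat split]; lra.
Qed.

Lemma form_of_rescale (K : fieldType) n (g : 'I_n -> K) (l : seq (seq nat * K)) :
  all (fun x => \prod_(i in index_set (n := n) x.1) g i != 0) l ->
  form_of (fun=> 1) l =
  form_of g [seq (x.1, x.2 / \prod_(i in index_set (n := n) x.1) g i) | x <- l].
Proof.
move=> /allP nz; rewrite /form_of big_map; apply: eq_big_seq => x /nz nzx.
by rewrite /scaled_monomial big1 // scale1r scalerA divfK.
Qed.

Let D := Num.sqrt (r ^+ 4 - 1).

(* The components in the orthonormal coframe e^i: besides a, b and c = r, the
   scales of the paper satisfy f = D / r and dt/dr = r^2 / D. *)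
Lemma curvature_two_form (M0 M1 M2 : R -> 'M[R]_3) i j :
  exists a b, [/\ 0 < a /\ 0 < b, a ^+ 2 = (r ^+ 2 - 1) / 2, b ^+ 2 = (r ^+ 2 + 1) / 2,
    a * b = D / 2 &
  curvature (connection_of M0 M1 M2) r i j = form_of (calabi_scale r)
  (two_form_code (entry_derive M0 r i j / r)
     (entry_derive M1 r i j / (r ^+ 3 / D)) (entry_derive M2 r i j / (r ^+ 3 / D))
     ((bracket (M1 r) (M2 r) i j - 2 * M0 r i j) / r ^+ 2)
     ((- bracket (M0 r) (M1 r) i j + 2 * M2 r i j) / D)
     ((- bracket (M0 r) (M2 r) i j - 2 * M1 r i j) / D)
     (- M0 r i j / a ^+ 2) (M0 r i j / b ^+ 2)
     (M1 r i j / (a * b)) (M1 r i j / (a * b))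
     (M2 r i j / (a * b)) (- M2 r i j / (a * b)))].
Proof.
have r0 : 0 < r by exact: lt_trans r_gt1.
have r2 : 0 < r ^+ 2 - 1 by rewrite subr_gt0 exprn_egt1.
have r2' : 0 < r ^+ 2 + 1 by rewrite addr_gt0 ?exprn_gt0.
have r4 : 0 < r ^+ 4 - 1 by rewrite subr_gt0 exprn_egt1.
exists (Num.sqrt ((r ^+ 2 - 1) / 2)), (Num.sqrt ((r ^+ 2 + 1) / 2)).
split.
- by split; rewrite sqrtr_gt0 divr_gt0.
- by rewrite sqr_sqrtr // ltW // divr_gt0.
- by rewrite sqr_sqrtr // ltW // divr_gt0.
- rewrite -sqrtrM; last by rewrite ltW // divr_gt0.
  rewrite (_ : (r ^+ 2 - 1) / 2 * ((r ^+ 2 + 1) / 2) = (r ^+ 4 - 1) / 2 ^+ 2); last by field.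
  by rewrite sqrtrM ?ltW // sqrtrV // sqrtr_sqr ger0_norm.
have hE : Num.sqrt (r ^+ 4 / (r ^+ 4 - 1)) = r ^+ 2 / D.
  rewrite sqrtrM ?exprn_ge0 ?ltW // sqrtrV ?ltW //; congr (_ / _).
  by rewrite (_ : r ^+ 4 = (r ^+ 2) ^+ 2) ?sqrtr_sqr ?ger0_norm ?sqr_ge0 -?exprM.
have D0 : D != 0 by rewrite gt_eqF // sqrtr_gt0.
have r_neq0 : r != 0 by rewrite gt_eqF.
rewrite curvature_connection_of (form_of_rescale _ _ (calabi_scale r)); last first.
  by rewrite /= !prod_scale_neq0.
rewrite /= !prod_scale // !big_cons !big_nil !mulr1 /calabi_scale !inordK //= hE -/D.
rewrite -!expr2 /two_form_code.
(* The scales of e^07, of e^05 and e^06, and of e^57 and e^67. *)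
have e1 : r ^+ 2 / D * (r^-1 * D) = r by field; apply/andP.
have e2 : r ^+ 2 / D * r = r ^+ 3 / D by field.
have e3 : r * (r^-1 * D) = D by field.
by rewrite e1 e2 e3.
Qed.
End PrimitiveTwoForms.

(** * Classification *)

Section LinearODE.
Context {R : realType}.
Implicit Types f g dg : R -> R.

Lemma derive1_locally_cst f (k r : R) :
  (forall s, 1 < s -> f s = k) -> 1 < r -> f^`()%classic r = 0.
Proof.
move=> fk r1; rewrite derive1E (near_eq_derive (g := cst k)) ?derive_cst //.
have : \forall s \near r, s \in `]1, +oo[ by apply: near_in_itvoy; rewrite in_itv /= r1.
by apply: filterS => s; rewrite in_itv /= andbT => /fk.
Qed.

(** The left-hand side of the equation is the derivative of [f * g], so it says that this product is
    constant on (1,oo). *)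
Lemma ode_solution f g dg :
  (forall r, 1 < r -> derivable f r 1) ->
  (forall r : R, 1 < r -> is_derive r 1 g (dg r)) ->
  (forall r, 1 < r -> g r != 0) ->
  (forall r, 1 < r -> f^`()%classic r * g r + f r * dg r = 0) <->
  exists c, forall r, 1 < r -> f r = c / g r.
Proof.
move=> df ddg g0.
have dfg (r : R) : 1 < r -> is_derive r 1 (f * g) (f^`()%classic r * g r + f r * dg r).
  move=> r1; have := ddg r r1; have := derivableP (df r r1); rewrite -derive1E => ? ?.
  apply: is_derive_eq; rewrite addrC /GRing.scale /=.
  by congr (_ + _); exact: mulrC.
split=> [H|[c fc] r r1]; last first.
  rewrite -(derive1_locally_cst (f * g) c r) // => [|s s1].
    by rewrite [RHS]derive1E; have [_ ->] := dfg r r1.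
  by rewrite /= /GRing.mul /= fc // mulfVK // g0.
(* The point 2 is an arbitrary base point in (1,oo); the mean value theorem compares any other point
   with it. *)
exists (f 2 * g 2) => r r1; suff <- : f r * g r = f 2 * g 2 by rewrite mulfK // g0.
have cst_lt x y : 1 < x -> x < y -> f x * g x = f y * g y.
  move=> x1 xy; have in_gt1 z : z \in `[x, y] -> 1 < z.
    by rewrite in_itv /= => /andP[xz _]; exact: lt_le_trans xz.
  have [z zxy|//|z _] := @MVT R (f * g) (fun=> 0) x y xy.
  - have z1 : 1 < z by apply: in_gt1; apply: subset_itv_oo_cc.
    by rewrite -(H z z1); apply: dfg.
  - apply: derivable_within_continuous => z /in_gt1 z1.
    by have := dfg z z1 => ?; apply: ex_derive.
  - by rewrite mul0r => /eqP; rewrite subr_eq0 => /eqP/esym.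
have [r2|r2|->//] := ltgtP r 2; first exact: cst_lt.
by apply/esym/cst_lt => //; lra.
Qed.

End LinearODE.

(** * Instanton equations for the three Kahler forms *)

Section Classification.
Context {R : realType}.
Implicit Types (M : R -> 'M[R]_3).

Definition entrywise_derivable M :=
  forall (r : R) i j, 1 < r -> derivable (fun s => M s i j) r 1.

Lemma ode_solution_mx M (g dg : R -> R) : entrywise_derivable M ->
  (forall r : R, 1 < r -> is_derive r 1 g (dg r)) ->
  (forall r, 1 < r -> g r != 0) ->
  (forall r i j, 1 < r -> entry_derive M r i j * g r + M r i j * dg r = 0) <->
  exists C : 'M[R]_3, forall r, 1 < r -> M r = (g r)^-1 *: C.
Proof.
move=> dM ddg g0.
have ode i j := ode_solution (fun s => M s i j) g dg (fun r => dM r i j) ddg g0.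
split=> [H|[C MC] r i j r1]; last first.
  rewrite mxE; apply: (ode i j).2 r1; exists (C i j) => s s1.
  by rewrite MC // mxE mulrC.
(* The constants exist entry by entry; choosing them makes a single matrix. *)
have /(_ _ _)/cid c i j : exists c, forall r, 1 < r -> M r i j = c / g r.
  by apply/ode => r r1; have := H r i j r1; rewrite mxE.
exists (\matrix_(i, j) projT1 (c i j)) => r r1; apply/matrixP => i j.
by rewrite !mxE mulrC; case: (c i j) => /= x; apply.
Qed.

Lemma entry_derive0 M r : (forall s, 1 < s -> M s = 0) -> 1 < r -> entry_derive M r = 0.
Proof.
move=> M0 r1; apply/matrixP => i j; rewrite !mxE.
by apply: (derive1_locally_cst _ 0) => // s /M0->; rewrite mxE.
Qed.

Lemma bracket0l (N : 'M[R]_3) : bracket 0 N = 0.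
Proof. by rewrite /bracket mul0mx mulmx0 subr0. Qed.

Lemma bracket0r (N : 'M[R]_3) : bracket N 0 = 0.
Proof. by rewrite /bracket mul0mx mulmx0 subr0. Qed.

Lemma mx0E i j : (0 : 'M[R]_3) i j = 0.
Proof. by rewrite mxE. Qed.

Lemma instanton_I M0 M1 M2 :
  su4_instanton (@omega_I R) (connection_of M0 M1 M2) <->
  [/\ forall r, 1 < r -> M1 r = 0, forall r, 1 < r -> M2 r = 0 &
      forall r i j, 1 < r ->
        entry_derive M0 r i j * (r ^+ 2 * (1 - r ^+ 4))
        + M0 r i j * (2 * r - 6 * r ^+ 5) = 0].
Proof.
(* The trace condition for I, written as the differential equation divided by a factor that does not
   vanish for r > 1. Here 1/a^2 + 1/b^2 = 4r^2/(r^4-1). *)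
have trace (r a b m' m : R) : 1 < r -> a ^+ 2 = (r ^+ 2 - 1) / 2 -> b ^+ 2 = (r ^+ 2 + 1) / 2 ->
    m' / r - ((0 - 2 * m) / r ^+ 2 + - m / a ^+ 2 - m / b ^+ 2) =
    (m' * (r ^+ 2 * (1 - r ^+ 4)) + m * (2 * r - 6 * r ^+ 5)) / (r ^+ 3 * (1 - r ^+ 4)).
  move=> r1 -> ->.
  have r0 : 0 < r by exact: lt_trans r1.
  have r2 : r ^+ 2 - 1 != 0 by rewrite gt_eqF // subr_gt0 exprn_egt1.
  have r2' : r ^+ 2 + 1 != 0 by rewrite gt_eqF // addr_gt0 ?exprn_gt0.
  have r4 : 1 - r ^+ 4 != 0 by rewrite lt_eqF // subr_lt0 exprn_egt1.
  by field; rewrite r2 r2' r4 gt_eqF.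
have nz (r : R) : 1 < r -> r ^+ 3 * (1 - r ^+ 4) != 0.
  move=> r1; rewrite mulf_neq0 ?expf_neq0 //; first by rewrite gt_eqF // (lt_trans _ r1).
  by rewrite lt_eqF // subr_lt0 exprn_egt1.
split=> [H|[Z1 Z2 E] r r1 i j]; last first.
  have [a [b [[a0 b0] ea eb eab ->]]] := curvature_two_form r r1 M0 M1 M2 i j.
  apply/primitive_I => //.
  rewrite Z1 // Z2 // (entry_derive0 M1) // (entry_derive0 M2) //.
  rewrite bracket0l bracket0r !mx0E !(mulr0, mul0r, subr0, addr0, oppr0).
  by split=> //; apply/eqP; rewrite -subr_eq0 trace // E // mul0r.
have {}H r i j (r1 : 1 < r) := H r r1 i j.
have Z12 r i j : 1 < r -> M1 r i j = 0 /\ M2 r i j = 0.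
  move=> r1; have := H r i j r1.
  have [a [b [[a0 b0] ea eb eab ->]]] := curvature_two_form r r1 M0 M1 M2 i j.
  move=> /(primitive_I _ r1)[_ _ e24 e14 _].
  (* By the structure equations the components 13 and 24 are both M1/(ab), and 23 and 14 are M2/(ab)
     and its opposite. Type (1,1) asks for the reverse signs, so both entries vanish. *)
  have ab0 : (a * b)^-1 != 0 by rewrite invr_neq0 // mulf_neq0 // gt_eqF.
  by split; apply: (mulIf ab0); lra.
have Z1 r : 1 < r -> M1 r = 0.
  by move=> r1; apply/matrixP => i j; rewrite mxE; case: (Z12 r i j r1).
have Z2 r : 1 < r -> M2 r = 0.
  by move=> r1; apply/matrixP => i j; rewrite mxE; case: (Z12 r i j r1).
split=> // r i j r1; have := H r i j r1.
have [a [b [[a0 b0] ea eb eab ->]]] := curvature_two_form r r1 M0 M1 M2 i j.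
move=> /(primitive_I _ r1)[_ _ _ _].
rewrite Z1 // Z2 // bracket0l !mx0E => /eqP; rewrite -subr_eq0 trace //.
by rewrite mulf_eq0 invr_eq0 (negPf (nz r r1)) orbF => /eqP.
Qed.

(** The trace conditions for J, as an equation in M2, and for K, as an equation in M1, coincide once
    ab = D/2 is used; clearing r^3 D and D^2 = r^4 - 1 removes the square root. *)
Lemma trace_JK (r m' m : R) : 1 < r ->
  let D := Num.sqrt (r ^+ 4 - 1) in
  m' / (r ^+ 3 / D) - (- (2 * m) / D - m / (D / 2) - m / (D / 2)) = 0 <->
  m' * (r ^+ 4 - 1) + m * (6 * r ^+ 3) = 0.
Proof.
move=> r1 D; have r0 : r != 0 by rewrite gt_eqF // (lt_trans _ r1).
have D0 : D != 0 by rewrite gt_eqF // sqrtr_gt0 subr_gt0 exprn_egt1.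
have <- : D ^+ 2 = r ^+ 4 - 1 by rewrite sqr_sqrtr // ltW // subr_gt0 exprn_egt1.
have -> : m' / (r ^+ 3 / D) - (- (2 * m) / D - m / (D / 2) - m / (D / 2)) =
    (m' * D ^+ 2 + m * (6 * r ^+ 3)) / (r ^+ 3 * D) by field; apply/andP.
have nz : r ^+ 3 * D != 0 by rewrite mulf_neq0 ?expf_neq0.
by split=> [/eqP|->]; rewrite ?mul0r // mulf_eq0 invr_eq0 (negPf nz) orbF => /eqP.
Qed.

Lemma instanton_J M0 M1 M2 :
  su4_instanton (@omega_J R) (connection_of M0 M1 M2) <->
  [/\ forall r, 1 < r -> M0 r = 0, forall r, 1 < r -> M1 r = 0 &
      forall r i j, 1 < r ->
        entry_derive M2 r i j * (r ^+ 4 - 1) + M2 r i j * (6 * r ^+ 3) = 0].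
Proof.
split=> [H|[Z0 Z1 E] r r1 i j]; last first.
  have [a [b [[a0 b0] ea eb eab ->]]] := curvature_two_form r r1 M0 M1 M2 i j.
  apply/primitive_J => //.
  rewrite Z0 // Z1 // (entry_derive0 M0) // (entry_derive0 M1) // eab.
  rewrite !bracket0l !mx0E !(mulr0, mul0r, subr0, addr0, add0r, oppr0).
  split=> //; apply/eqP; rewrite -subr_eq0; apply/eqP.
  by have /(trace_JK _ _ _ r1) := E r i j r1; rewrite !mulNr.
have {}H r i j (r1 : 1 < r) := H r r1 i j.
have Z01 r i j : 1 < r -> M0 r i j = 0 /\ M1 r i j = 0.
  move=> r1; have := H r i j r1.
  have [a [b [[a0 b0] ea eb eab ->]]] := curvature_two_form r r1 M0 M1 M2 i j.
  move=> /(primitive_J _ r1)[_ _ e24 e34 _].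
  have ab0 : (a * b)^-1 != 0 by rewrite invr_neq0 // mulf_neq0 // gt_eqF.
  (* Equality of the components 12 and 34 reads -M0/a^2 = M0/b^2, so a positive factor times M0 is
     zero; M1 vanishes through 13 and 24, as for I. *)
  have ab2 : (a ^+ 2)^-1 + (b ^+ 2)^-1 != 0.
    by rewrite gt_eqF // addr_gt0 // invr_gt0 exprn_gt0.
  by split; [apply: (mulIf ab2) | apply: (mulIf ab0)]; lra.
have Z0 r : 1 < r -> M0 r = 0.
  by move=> r1; apply/matrixP => i j; rewrite mxE; case: (Z01 r i j r1).
have Z1 r : 1 < r -> M1 r = 0.
  by move=> r1; apply/matrixP => i j; rewrite mxE; case: (Z01 r i j r1).
split=> // r i j r1; have := H r i j r1.
have [a [b [[a0 b0] ea eb eab ->]]] := curvature_two_form r r1 M0 M1 M2 i j.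
move=> /(primitive_J _ r1)[_ _ _ _].
rewrite Z0 // bracket0l !mx0E eab oppr0 add0r => e.
by apply/(trace_JK _ _ _ r1); rewrite e !mulNr subrr.
Qed.

Lemma instanton_K M0 M1 M2 :
  su4_instanton (@omega_K R) (connection_of M0 M1 M2) <->
  [/\ forall r, 1 < r -> M0 r = 0, forall r, 1 < r -> M2 r = 0 &
      forall r i j, 1 < r ->
        entry_derive M1 r i j * (r ^+ 4 - 1) + M1 r i j * (6 * r ^+ 3) = 0].
Proof.
split=> [H|[Z0 Z2 E] r r1 i j]; last first.
  have [a [b [[a0 b0] ea eb eab ->]]] := curvature_two_form r r1 M0 M1 M2 i j.
  apply/primitive_K => //.
  rewrite Z0 // Z2 // (entry_derive0 M0) // (entry_derive0 M2) // eab.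
  rewrite !bracket0l bracket0r !mx0E !(mulr0, mul0r, subr0, addr0, sub0r, oppr0).
  split=> //; apply/eqP; rewrite -subr_eq0; apply/eqP.
  by have /(trace_JK _ _ _ r1) := E r i j r1.
have {}H r i j (r1 : 1 < r) := H r r1 i j.
have Z02 r i j : 1 < r -> M0 r i j = 0 /\ M2 r i j = 0.
  move=> r1; have := H r i j r1.
  have [a [b [[a0 b0] ea eb eab ->]]] := curvature_two_form r r1 M0 M1 M2 i j.
  move=> /(primitive_K _ r1)[_ _ e14 e34 _].
  have ab0 : (a * b)^-1 != 0 by rewrite invr_neq0 // mulf_neq0 // gt_eqF.
  (* M0 vanishes as for J, and M2 through the components 14 and 23. *)
  have ab2 : (a ^+ 2)^-1 + (b ^+ 2)^-1 != 0.
    by rewrite gt_eqF // addr_gt0 // invr_gt0 exprn_gt0.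
  by split; [apply: (mulIf ab2) | apply: (mulIf ab0)]; lra.
have Z0 r : 1 < r -> M0 r = 0.
  by move=> r1; apply/matrixP => i j; rewrite mxE; case: (Z02 r i j r1).
have Z2 r : 1 < r -> M2 r = 0.
  by move=> r1; apply/matrixP => i j; rewrite mxE; case: (Z02 r i j r1).
split=> // r i j r1; have := H r i j r1.
have [a [b [[a0 b0] ea eb eab ->]]] := curvature_two_form r r1 M0 M1 M2 i j.
move=> /(primitive_K _ r1)[_ _ _ _].
rewrite Z0 // bracket0l !mx0E eab oppr0 sub0r => e.
by apply/(trace_JK _ _ _ r1); rewrite e subrr.
Qed.

Lemma instanton_ode_I M : entrywise_derivable M ->
  (forall r i j, 1 < r ->
     entry_derive M r i j * (r ^+ 2 * (1 - r ^+ 4))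
     + M r i j * (2 * r - 6 * r ^+ 5) = 0) <->
  exists C : 'M[R]_3, forall r, 1 < r -> M r = (r ^+ 2 * (1 - r ^+ 4))^-1 *: C.
Proof.
move=> dM; apply: (ode_solution_mx _ (fun r => r ^+ 2 * (1 - r ^+ 4))
    (fun r => 2 * r - 6 * r ^+ 5)) => // [r _|r r1].
  by apply: is_derive_eq; rewrite /GRing.scale /=; ring.
rewrite mulf_neq0 ?expf_neq0 //; first by rewrite gt_eqF // (lt_trans _ r1).
by rewrite lt_eqF // subr_lt0 exprn_egt1.
Qed.

(** With g = (r^4-1)^(3/2), both g and g' contain the positive factor (r^4-1)^(1/2); dividing (g M)'
    = 0 by it leaves the equation with polynomial coefficients. The exponent is kept as [3 / 2 - 1],
    the form given by the power rule. *)
Lemma instanton_ode_JK M : entrywise_derivable M ->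
  (forall r i j, 1 < r ->
     entry_derive M r i j * (r ^+ 4 - 1) + M r i j * (6 * r ^+ 3) = 0) <->
  exists C : 'M[R]_3, forall r, 1 < r -> M r = ((r ^+ 4 - 1) `^ (3 / 2))^-1 *: C.
Proof.
move=> dM; pose g (r : R) := (r ^+ 4 - 1) `^ (3 / 2).
have gE (r : R) : 1 < r -> g r = (r ^+ 4 - 1) * (r ^+ 4 - 1) `^ (3 / 2 - 1).
  move=> r1; have r4 : 0 < r ^+ 4 - 1 by rewrite subr_gt0 exprn_egt1.
  rewrite -[X in X * _]powRr1 ?ltW // -powRD ?gt_eqF ?implybT //.
  by congr (_ `^ _); lra.
have pos (r : R) : 1 < r -> 0 < (r ^+ 4 - 1) `^ (3 / 2 - 1).
  by move=> r1; rewrite powR_gt0 // subr_gt0 exprn_egt1.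
have dg (r : R) : 1 < r ->
    is_derive r 1 g (6 * r ^+ 3 * (r ^+ 4 - 1) `^ (3 / 2 - 1)).
  move=> r1; have := @is_derive1_powR R (3 / 2) (r ^+ 4 - 1).
  rewrite subr_gt0 exprn_egt1 // => /(_ isT) dp.
  have dq : is_derive r 1 (fun x : R => x ^+ 4 - 1) (4 * r ^+ 3).
    by apply: is_derive_eq; rewrite /GRing.scale /=; ring.
  have := @is_derive1_comp R (powR (R:=R) ^~ (3 / 2)) (fun x : R => x ^+ 4 - 1) r _ _ dp dq.
  by move=> dg; apply: (is_derive_eq dg); field.
have g0 (r : R) : 1 < r -> g r != 0.
  by move=> r1; rewrite gt_eqF // powR_gt0 // subr_gt0 exprn_egt1.
apply: iff_trans (ode_solution_mx M g _ dM dg g0).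
split=> H r i j r1.
  transitivity ((entry_derive M r i j * (r ^+ 4 - 1) + M r i j * (6 * r ^+ 3))
                * (r ^+ 4 - 1) `^ (3 / 2 - 1)); first by rewrite gE //; ring.
  by rewrite H // mul0r.
have P0 : (r ^+ 4 - 1) `^ (3 / 2 - 1) != 0 by rewrite gt_eqF // pos.
apply: (mulIf P0).
by rewrite mul0r -[RHS](H r i j r1) gE //; ring.
Qed.

End Classification.

(** * Coordinates in so(3) and the final statement *)

Section SO3Connections.
Context {R : realType}.

Definition so3_of (p q s : R) : 'M[R]_3 := p *: so3_T1 R + q *: so3_T2 R + s *: so3_T3 R.

(** Each coordinate in the basis T_1, T_2, T_3 is an entry of the matrix, so matrix equations can be
    read back as scalar ones. *)
Lemma so3_of_entries p q s :
  [/\ so3_of p q s 2 1 = p, so3_of p q s 0 2 = q & so3_of p q s 1 0 = s].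
Proof. by split; rewrite !mxE /=; ring. Qed.

Lemma so3_ofZ k p q s : k *: so3_of p q s = so3_of (k * p) (k * q) (k * s).
Proof. by rewrite /so3_of !scalerDr !scalerA. Qed.

Lemma so3_of_eq0 p q s : so3_of p q s = 0 <-> [/\ p = 0, q = 0 & s = 0].
Proof.
split=> [e|[-> -> ->]]; last by rewrite /so3_of !scale0r !addr0.
by have := so3_of_entries p q s; rewrite e !mxE => -[].
Qed.

Lemma inv_connectionE p0 p1 p2 q0 q1 q2 s0 s1 s2 :
  inv_connection p0 p1 p2 q0 q1 q2 s0 s1 s2 =
  connection_of (fun r => so3_of (p0 r) (q0 r) (s0 r))
    (fun r => so3_of (p1 r) (q1 r) (s1 r)) (fun r => so3_of (p2 r) (q2 r) (s2 r)).
Proof.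
apply/funext => r; apply/matrixP => i j; apply/ffunP => A.
rewrite /inv_connection /tensor /so3_of !mxE.
by rewrite !ffunE /GRing.scale /=; ring.
Qed.

Lemma so3_of_derivable p q s : smooth_gt1 p -> smooth_gt1 q -> smooth_gt1 s ->
  entrywise_derivable (fun r => so3_of (p r) (q r) (s r)).
Proof.
move=> hp hq hs r i j r1.
have scaled f (c : R) : smooth_gt1 f -> derivable (fun s => f s * c) r 1.
  by move=> hf; apply: derivableM; [exact: (hf 0%N) | exact: derivable_cst].
under eq_fun do rewrite !mxE.
exact: derivableD (derivableD (scaled _ _ hp) (scaled _ _ hq)) (scaled _ _ hs).
Qed.

Lemma so3_of_solution (g p q s : R -> R) :
  (exists C : 'M[R]_3, forall r, 1 < r -> so3_of (p r) (q r) (s r) = (g r)^-1 *: C) <->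
  exists c1 c2 c3, forall r, 1 < r ->
    [/\ p r = c1 / g r, q r = c2 / g r & s r = c3 / g r].
Proof.
split=> [[C H]|[c1 [c2 [c3 H]]]].
  (* [C] is an arbitrary matrix; the witnesses are its entries at the positions that read off
     coordinates in so(3). *)
  exists (C 2 1), (C 0 2), (C 1 0) => r r1.
  have := so3_of_entries (p r) (q r) (s r).
  by rewrite H // !mxE ![(g r)^-1 * _]mulrC => -[-> -> ->].
exists (so3_of c1 c2 c3) => r /H[-> -> ->].
by rewrite so3_ofZ; congr so3_of; rewrite mulrC.
Qed.

End SO3Connections.

Theorem theorem6p7 (R : realType) (p0 p1 p2 q0 q1 q2 s0 s1 s2 : R -> R)
    (hp0 : smooth_gt1 p0) (hp1 : smooth_gt1 p1) (hp2 : smooth_gt1 p2)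
    (hq0 : smooth_gt1 q0) (hq1 : smooth_gt1 q1) (hq2 : smooth_gt1 q2)
    (hs0 : smooth_gt1 s0) (hs1 : smooth_gt1 s1) (hs2 : smooth_gt1 s2) :
  let A := inv_connection p0 p1 p2 q0 q1 q2 s0 s1 s2 in
  [/\ su4_instanton (@omega_I R) A <->
      exists C1 C2 C3 : R, forall r : R, 1 < r ->
        [/\ p0 r = C1 / (r ^+ 2 * (1 - r ^+ 4)),
            q0 r = C2 / (r ^+ 2 * (1 - r ^+ 4)) &
            s0 r = C3 / (r ^+ 2 * (1 - r ^+ 4))] /\
        [/\ p1 r = 0, p2 r = 0 & q1 r = 0] /\
        [/\ q2 r = 0, s1 r = 0 & s2 r = 0],
      su4_instanton (@omega_J R) A <->
      exists C1 C2 C3 : R, forall r : R, 1 < r ->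
        [/\ p2 r = C1 / (r ^+ 4 - 1) `^ (3 / 2),
            q2 r = C2 / (r ^+ 4 - 1) `^ (3 / 2) &
            s2 r = C3 / (r ^+ 4 - 1) `^ (3 / 2)] /\
        [/\ p0 r = 0, p1 r = 0 & q0 r = 0] /\
        [/\ q1 r = 0, s0 r = 0 & s1 r = 0] &
      su4_instanton (@omega_K R) A <->
      exists C1 C2 C3 : R, forall r : R, 1 < r ->
        [/\ p1 r = C1 / (r ^+ 4 - 1) `^ (3 / 2),
            q1 r = C2 / (r ^+ 4 - 1) `^ (3 / 2) &
            s1 r = C3 / (r ^+ 4 - 1) `^ (3 / 2)] /\
        [/\ p0 r = 0, p2 r = 0 & q0 r = 0] /\
        [/\ q2 r = 0, s0 r = 0 & s2 r = 0]].
Proof.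
move=> A; rewrite /A inv_connectionE.
have d0 := so3_of_derivable _ _ _ hp0 hq0 hs0.
have d1 := so3_of_derivable _ _ _ hp1 hq1 hs1.
have d2 := so3_of_derivable _ _ _ hp2 hq2 hs2.
split.
- split=> [/instanton_I[Z1 Z2 /(instanton_ode_I _ d0)/so3_of_solution[c1 [c2 [c3 E]]]]|].
    exists c1, c2, c3 => r r1.
    have [? ? ?] := (so3_of_eq0 _ _ _).1 (Z1 r r1).
    by have [? ? ?] := (so3_of_eq0 _ _ _).1 (Z2 r r1); have [] := E r r1.
  move=> [c1 [c2 [c3 H]]]; apply/instanton_I.
  split=> [r /H[_ [[? ? ?] [? ? ?]]]|r /H[_ [[? ? ?] [? ? ?]]]|].
  - exact/so3_of_eq0.
  - exact/so3_of_eq0.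
  - apply/(instanton_ode_I _ d0)/so3_of_solution.
    by exists c1, c2, c3 => r /H[].
- split=> [/instanton_J[Z0 Z1 /(instanton_ode_JK _ d2)/so3_of_solution[c1 [c2 [c3 E]]]]|].
    exists c1, c2, c3 => r r1.
    have [? ? ?] := (so3_of_eq0 _ _ _).1 (Z0 r r1).
    by have [? ? ?] := (so3_of_eq0 _ _ _).1 (Z1 r r1); have [] := E r r1.
  move=> [c1 [c2 [c3 H]]]; apply/instanton_J.
  split=> [r /H[_ [[? ? ?] [? ? ?]]]|r /H[_ [[? ? ?] [? ? ?]]]|].
  - exact/so3_of_eq0.
  - exact/so3_of_eq0.
  - apply/(instanton_ode_JK _ d2)/so3_of_solution.
    by exists c1, c2, c3 => r /H[].
- split=> [/instanton_K[Z0 Z2 /(instanton_ode_JK _ d1)/so3_of_solution[c1 [c2 [c3 E]]]]|].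
    exists c1, c2, c3 => r r1.
    have [? ? ?] := (so3_of_eq0 _ _ _).1 (Z0 r r1).
    by have [? ? ?] := (so3_of_eq0 _ _ _).1 (Z2 r r1); have [] := E r r1.
  move=> [c1 [c2 [c3 H]]]; apply/instanton_K.
  split=> [r /H[_ [[? ? ?] [? ? ?]]]|r /H[_ [[? ? ?] [? ? ?]]]|].
  - exact/so3_of_eq0.
  - exact/so3_of_eq0.
  - apply/(instanton_ode_JK _ d1)/so3_of_solution.
    by exists c1, c2, c3 => r /H[].
Qed.
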